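(* For every integer $r\ge1$, \[p_r(A)=\sum_{k=0}^{r-1}\binom{r-1}{k}\binom{r}{k}q^k.\]
   Context: $q$ is an indeterminate. The Narayana polynomials are $C_0(q)=1$ and $C_n(q)=\sum_{k=1}^n \frac1n\binom{n}{k-1}\binom{n}{k}q^{k-1}$ for $n\ge1$. The ''Narayana alphabet'' $A$ is the specialization of the ring of symmetric functions (over $\mathbb{Q}$) to $\mathbb{Q}[q]$ sending the complete symmetric function $h_n$ to $C_n(q)$ for all $n\ge0$. The power sums $p_r(A)$ are the images of the power-sum symmetric functions; equivalently they are determined by $\sum_{r\ge1}p_r(A)u^{r-1}=\frac{d}{du}\log\Big(\sum_{n\ge0}C_n(q)u^n\Big)$, or by Newton's identities $nC_n(q)=\sum_{r=0}^{n-1}C_r(q)\,p_{n-r}(A)$ for $n\ge1$. *)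

(* Defs.v *)
From HB Require Import structures.
From mathcomp Require Import all_boot all_fingroup all_algebra.
From mathcomp Require Import boolp.
From mathcomp Require Import mpoly.

Set Implicit Arguments.
Unset Strict Implicit.
Unset Printing Implicit Defensive.

Import GRing.Theory.
Local Open Scope ring_scope.

(* The substitution of 0 for the last of n+1 variables. *)
Definition mrestr (R : comNzRingType) (n : nat) (p : {mpoly R[n.+1]}) :
    {mpoly R[n]} :=
  mmap (@mpolyC n R)
       (fun i => if unlift ord_max i is Some j then 'X_j else 0) p.

Section Restriction.
Context (R : comNzRingType) (n : nat).
Implicit Types p q : {mpoly R[n.+1]}.

Lemma mrestr0 : mrestr 0 = 0 :> {mpoly R[n]}.
Proof. exact: mmap0. Qed.

Lemma mrestrN : {morph @mrestr R n : p / - p}.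
Proof. exact: mmapN. Qed.

Lemma mrestrD : {morph @mrestr R n : p q / p + q}.
Proof. exact: mmapD. Qed.

Lemma mrestr1 : mrestr 1 = 1 :> {mpoly R[n]}.
Proof. by rewrite /mrestr mmapC. Qed.

Lemma mrestrM : {morph @mrestr R n : p q / p * q}.
Proof.
by move=> p q; rewrite /mrestr rmorphM.
Qed.

Lemma mrestrZ c : {morph @mrestr R n : p / c *: p}.
Proof. by move=> p; rewrite /mrestr mmapZ mul_mpolyC. Qed.

Lemma mrestrX m :
  mrestr 'X_[m] = if m ord_max == 0%N
                  then 'X_[[multinom m (lift ord_max i) | i < n]]
                  else 0 :> {mpoly R[n]}.
Proof.
rewrite /mrestr mmapX /mmap1 big_ord_recr /= unlift_none expr0n.
case: eqP => _; last by rewrite mulr0.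
rewrite mulr1 [RHS]mpolyXE_id; apply: eq_bigr => i _.
have -> : widen_ord (leqnSn n) i = lift ord_max i.
  by apply/val_inj; rewrite /= /bump leqNgt ltn_ord.
by rewrite liftK mnmE.
Qed.

Lemma mcoeff_mrestr p m : (mrestr p)@_m = p@_(mnmwiden m).
Proof.
have mrestr_sum I (s : seq I) F : mrestr (\sum_(i <- s) F i : {mpoly R[n.+1]})
    = \sum_(i <- s) mrestr (F i).
  exact: (big_morph _ mrestrD mrestr0).
rewrite {1}[p]mpolyE mrestr_sum raddf_sum /= [in RHS](mpolyE p) raddf_sum /=.
apply: eq_bigr => k _; rewrite mrestrZ !mcoeffZ mrestrX mcoeffX.
have wl i : widen_ord (leqnSn n) i = lift ord_max i.
  by apply/val_inj; rewrite /= /bump leqNgt ltn_ord.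
congr (_ * _); case: eqP => [k0|k0].
  rewrite mcoeffX; congr (_ : bool)%:R; apply/eqP/eqP => [<-|->].
    apply/mnmP => i; case: (unliftP ord_max i) => [j|] ->.
      by rewrite -wl mnmwiden_widen mnmE wl.
    by rewrite mnmwiden_ordmax k0.
  by apply/mnmP => i; rewrite mnmE -wl mnmwiden_widen.
rewrite mcoeff0; case: eqP => // E.
by case: k0; rewrite E mnmwiden_ordmax.
Qed.

End Restriction.

(* A symmetric function over R: a sequence of symmetric polynomials f_n in n
   variables, of bounded degree, with f_(n+1)(x_0, ..., x_(n-1), 0) = f_n,
   i.e., an element of the inverse limit, taken in the category of graded
   rings, of the rings of symmetric polynomials. *)
Record symfun (R : comNzRingType) := SymFun {
  sfpoly :> forall n : nat, {mpoly R[n]};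
  sfpoly_sym : forall n : nat, sfpoly n \is symmetric;
  sfpoly_restr : forall n : nat, mrestr (sfpoly n.+1) = sfpoly n;
  sfpoly_bounded : exists d : nat, forall n : nat, (msize (sfpoly n) <= d)%N
}.

Section SymFunRing.
Context (R : comNzRingType).
Implicit Types f g h : symfun R.

HB.instance Definition _ := gen_eqMixin (symfun R).
HB.instance Definition _ := gen_choiceMixin (symfun R).

Lemma symfunP f g : (forall n, f n = g n) -> f = g.
Proof.
case: f g => [f fs fr fb] [g gs gr gb] /= fg.
have {}fg : f = g by apply: functional_extensionality_dep.
move: gs gr gb; rewrite -fg => gs gr gb.
by congr SymFun; apply: Prop_irrelevance.
Qed.

Definition symfun_zero : symfun R.
Proof.
exists (fun n => 0) => [n|n|]; first exact: rpred0.
- exact: mrestr0.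
- by exists 0%N => n; rewrite msize0.
Defined.

Definition symfun_opp f : symfun R.
Proof.
exists (fun n => - f n) => [n|n|]; first by rewrite rpredN sfpoly_sym.
- by rewrite mrestrN sfpoly_restr.
- by have [d df] := sfpoly_bounded f; exists d => n; rewrite msizeN.
Defined.

Definition symfun_add f g : symfun R.
Proof.
exists (fun n => f n + g n) => [n|n|]; first by rewrite rpredD ?sfpoly_sym.
- by rewrite mrestrD !sfpoly_restr.
- have [d df] := sfpoly_bounded f; have [e eg] := sfpoly_bounded g.
  exists (maxn d e) => n; apply: leq_trans (msizeD_le _ _) _.
  by rewrite geq_max !leq_max df eg orbT.
Defined.

Definition symfun_scale (c : R) f : symfun R.
Proof.
exists (fun n => c *: f n) => [n|n|]; first by rewrite rpredZ ?sfpoly_sym.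
- by rewrite mrestrZ sfpoly_restr.
- have [d df] := sfpoly_bounded f; exists d => n.
  exact: leq_trans (msizeZ_le _ _) _.
Defined.

Definition symfun_one : symfun R.
Proof.
exists (fun n => 1) => [n|n|]; first exact: rpred1.
- exact: mrestr1.
- by exists 1%N => n; rewrite msize1.
Defined.

Definition symfun_mul f g : symfun R.
Proof.
exists (fun n => f n * g n) => [n|n|]; first by rewrite rpredM ?sfpoly_sym.
- by rewrite mrestrM !sfpoly_restr.
- have [d df] := sfpoly_bounded f; have [e eg] := sfpoly_bounded g.
  exists (d + e).+1 => n; apply: leq_trans (msizeM_le _ _) _.
  by rewrite ltnS leq_add.
Defined.

Lemma symfun_addA : associative symfun_add.
Proof. by move=> f g h; apply: symfunP => n; apply: addrA. Qed.

Lemma symfun_addC : commutative symfun_add.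
Proof. by move=> f g; apply: symfunP => n; apply: addrC. Qed.

Lemma symfun_add0 : left_id symfun_zero symfun_add.
Proof. by move=> f; apply: symfunP => n; apply: add0r. Qed.

Lemma symfun_addN : left_inverse symfun_zero symfun_opp symfun_add.
Proof. by move=> f; apply: symfunP => n; apply: addNr. Qed.

HB.instance Definition _ := GRing.isZmodule.Build (symfun R)
  symfun_addA symfun_addC symfun_add0 symfun_addN.

Lemma symfun_mulA : associative symfun_mul.
Proof. by move=> f g h; apply: symfunP => n; apply: mulrA. Qed.

Lemma symfun_mulC : commutative symfun_mul.
Proof. by move=> f g; apply: symfunP => n; apply: mulrC. Qed.

Lemma symfun_mul1 : left_id symfun_one symfun_mul.
Proof. by move=> f; apply: symfunP => n; apply: mul1r. Qed.

Lemma symfun_mulDl : left_distributive symfun_mul symfun_add.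
Proof. by move=> f g h; apply: symfunP => n; apply: mulrDl. Qed.

Lemma symfun_one_neq0 : symfun_one != symfun_zero.
Proof.
apply/eqP => /(congr1 (fun f : symfun R => f 0%N)) /= /eqP.
by rewrite oner_eq0.
Qed.

HB.instance Definition _ := GRing.Zmodule_isComNzRing.Build (symfun R)
  symfun_mulA symfun_mulC symfun_mul1 symfun_mulDl symfun_one_neq0.

Lemma symfun_scaleA a b f :
  symfun_scale a (symfun_scale b f) = symfun_scale (a * b) f.
Proof. by apply: symfunP => n; apply: scalerA. Qed.

Lemma symfun_scale1 : left_id 1 symfun_scale.
Proof. by move=> f; apply: symfunP => n; apply: scale1r. Qed.

Lemma symfun_scaleDr : right_distributive symfun_scale +%R.
Proof. by move=> c f g; apply: symfunP => n; apply: scalerDr. Qed.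

Lemma symfun_scaleDl f : {morph symfun_scale^~ f : a b / a + b}.
Proof. by move=> a b; apply: symfunP => n; apply: scalerDl. Qed.

HB.instance Definition _ := GRing.Zmodule_isLmodule.Build R (symfun R)
  symfun_scaleA symfun_scale1 symfun_scaleDr symfun_scaleDl.

Lemma symfun_scaleAl (c : R) f g : c *: (f * g) = (c *: f) * g.
Proof. by apply: symfunP => n; apply: scalerAl. Qed.

HB.instance Definition _ := GRing.Lmodule_isLalgebra.Build R (symfun R)
  symfun_scaleAl.
HB.instance Definition _ := GRing.Lalgebra_isComAlgebra.Build R (symfun R).

Definition mcomplete (n k : nat) : {mpoly R[n]} :=
  \sum_(m : 'X_{1..n < k.+1} | mdeg m == k) 'X_[m].

Lemma mcoeff_mcomplete n k m : (mcomplete n k)@_m = (mdeg m == k)%:R.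
Proof.
rewrite /mcomplete raddf_sum /=.
under eq_bigr do rewrite mcoeffX.
have [mk|mk] := eqVneq (mdeg m) k.
  have lt_mk : (mdeg m < k.+1)%N by rewrite mk.
  rewrite (bigD1 (BMultinom lt_mk)) /= ?mk // eqxx big1 ?addr0 // => m'.
  by case/andP=> _; rewrite -val_eqE /= => /negbTE ->.
by apply: big1 => m' /eqP m'k; case: eqP => // E; rewrite -E m'k eqxx in mk.
Qed.

Definition sf_complete (k : nat) : symfun R.
Proof.
exists (fun n => mcomplete n k) => [n|n|].
- apply/issymP => s; apply/mpolyP => m.
  by rewrite mcoeff_sym !mcoeff_mcomplete mdeg_mperm.
- apply/mpolyP => m; rewrite mcoeff_mrestr !mcoeff_mcomplete !mdegE.
  rewrite big_ord_recr /= mnmwiden_ordmax addn0.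
  by under eq_bigr do rewrite mnmwiden_widen.
- exists k.+1 => n; rewrite msizeE; apply/bigmax_leqP_seq => m + _.
  rewrite mcoeff_msupp mcoeff_mcomplete ltnS.
  by have [->|_] := eqVneq (mdeg m) k; rewrite ?eqxx.
Defined.

(* The sequence of the sums of the r-th powers is stable under restriction
   only for r > 0. *)
Definition sf_power_sum (r : nat) (r_gt0 : (0 < r)%N) : symfun R.
Proof.
exists (fun n => \sum_(i < n) 'X_i ^+ r) => [n|n|].
- apply/issymP => s; rewrite raddf_sum /=.
  rewrite [RHS](reindex_inj (@perm_inj _ s)) /=.
  by apply: eq_bigr => i _; rewrite rmorphXn /= /msym mmapX mmap1U.
- rewrite /mrestr raddf_sum big_ord_recr /= [X in _ + X]rmorphXn /= mmapX mmap1U.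
  rewrite unlift_none expr0n gtn_eqF // addr0; apply: eq_bigr => i _.
  rewrite rmorphXn /= mmapX mmap1U.
  have -> : widen_ord (leqnSn n) i = lift ord_max i.
    by apply/val_inj; rewrite /= /bump leqNgt ltn_ord.
  by rewrite liftK.
- exists r.+1 => n; apply: leq_trans (msize_sum _ _ _) _.
  apply/bigmax_leqP => i _.
  by rewrite mpolyXn msizeX mdegMn mdeg1 mul1n.
Defined.

End SymFunRing.

Definition narayana (n : nat) : {poly rat} :=
  if n is 0 then 1 else
  \sum_(1 <= k < n.+1) (n%:R^-1 * 'C(n, k.-1)%:R * 'C(n, k)%:R) *: 'X^(k.-1).

(* A specialization of the ring of symmetric functions over Q to Q[q] is a
   morphism of Q-algebras; the image A f of f is what is written f(A). *)
Definition is_narayana_alphabet (A : {lrmorphism symfun rat -> {poly rat}}) :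
    Prop :=
  forall n : nat, A (sf_complete rat n) = narayana n.

(* Main.v *)
(* Let C and P be the generating series in u of the Narayana polynomials and of
   the claimed power sums. The closed formulas give three-term recurrences, that
   is, with D = 1 - 2(1+q)u + (q-1)^2 u^2,
     u D C' = ((1+q)u - 1) C + 1 + (1-q)u,
     D P = (1+q)u - 1 + (1 + (1-q)u)(1 + (q-1)u - quC).
   By the first equation, E = quC^2 - (1+(q-1)u)C + 1 satisfies
   uDE' = ((q-1)^2 u^2 - 1) E, whence E = 0, since this equation expresses (n+1)
   times the n-th coefficient of E through the previous ones. Then the second
   equation multiplied by C becomes D C P = u D C', i.e., C P = u C'. These are
   Newton's identities, which determine the power sums from the complete
   symmetric functions. *)
Require Import Defs.
From mathcomp Require Import all_boot all_algebra.
From mathcomp Require Import mpoly ring.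

Import GRing.Theory Num.Theory.
Local Open Scope ring_scope.

(** * Newton's identities between complete and power-sum symmetric functions *)

Lemma mcoeffMX_sub (n : nat) (R : comNzRingType) (p : {mpoly R[n]})
    (m k : 'X_{1..n}) :
  (p * 'X_[m])@_k = if (m <= k)%MM then p@_(k - m) else 0.
Proof.
case: ifPn => [le_mk|]; first by rewrite -{1}(submK le_mk) addmC mcoeffMX.
rewrite mcoeffM => nle_mk; apply: big1 => -[x y] /= /eqP kE.
rewrite mcoeffX; case: eqP => [my|]; last by rewrite mulr0.
case/negP: nle_mk; rewrite my.
suff lem_sum l : l = (x + y)%MM :> 'X_{1..n} -> (y <= l)%MM by exact: lem_sum.
by move->; apply: lem_addl.
Qed.

Lemma lem_mulmU (n : nat) (i : 'I_n) (d : nat) (m : 'X_{1..n}) :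
  (U_(i) *+ d <= m)%MM = (d <= m i)%N.
Proof.
apply/mnm_lepP/idP => [/(_ i)|le_d j]; rewrite mulmnE mnm1E.
  by rewrite eqxx mul1n.
by case: eqP => [<-|]; rewrite ?mul1n ?mul0n.
Qed.

Lemma mdeg_subU (n : nat) (i : 'I_n) (d : nat) (m : 'X_{1..n}) :
  (d <= m i)%N -> (mdeg (m - U_(i) *+ d) + d)%N = mdeg m.
Proof.
rewrite -lem_mulmU => /submK {2}<-.
by rewrite mdegD mdegMn mdeg1 mul1n.
Qed.

(** The coefficient of a monomial [m] of degree n+1 in h_i p_(n+1-i) counts the variables with
    exponent at least n+1-i. Over all i, variable j is counted [m j] times, and these exponents add
    up to n+1. *)
Lemma newton_complete (R : comNzRingType) (n : nat) :
  n.+1%:R * sf_complete R n.+1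
  = \sum_(i < n.+1) sf_complete R i * sf_power_sum R (ltn0Sn (n - i)).
Proof.
have sfE I (s : seq I) (F : I -> symfun R) k :
    (\sum_(i <- s) F i) k = \sum_(i <- s) F i k.
  by apply: (big_morph (fun f : symfun R => f k)).
have sfMn (f : symfun R) k d : (f *+ d) k = f k *+ d.
  by elim: d => [|d IH] //; rewrite !mulrS -IH.
apply: symfunP => k; rewrite mulr_natl sfMn sfE; apply/mpolyP => m.
rewrite mcoeffMn [LHS]/= mcoeff_mcomplete [RHS]raddf_sum /=.
under eq_bigr => i _.
  rewrite mulr_sumr raddf_sum /=.
  under eq_bigr => j _ do
    rewrite mpolyXn mcoeffMX_sub lem_mulmU mcoeff_mcomplete.
  over.
rewrite exchange_big /=.
have [dm|dm] := eqVneq (mdeg m) n.+1; last first.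
  rewrite mul0rn big1 // => j _; apply: big1 => i _.
  case: ifPn => // le_m; case: eqP => // dmB; case/eqP: dm.
  by rewrite -(mdeg_subU _ _ _ _ le_m) dmB addnS subnKC // -ltnS.
have sumE : (\sum_(j < k) m j)%N = n.+1 by rewrite -dm mdegE.
transitivity ((\sum_(j < k) m j)%:R : R); first by rewrite sumE.
rewrite natr_sum; apply: eq_bigr => j _.
have le_mj : (m j <= n.+1)%N by rewrite -dm mdegE (bigD1 j) //= leq_addr.
rewrite -[in LHS](card_ord (m j)) -sum1_card natr_sum.
rewrite (big_ord_widen n.+1 (fun=> 1)) // big_mkcond /=.
rewrite (reindex_inj rev_ord_inj) /=; apply: eq_bigr => i _.
rewrite subSS; case: ifP => // lt_m.
have le_in : (i <= n)%N by rewrite -ltnS.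
have := mdeg_subU _ _ _ _ lt_m; rewrite dm addnS => -[].
by rewrite -[RHS](subnKC le_in) => /addIn ->; rewrite eqxx.
Qed.

(** * Coefficients and three-term recurrences *)

Definition narayana_power_sum (r : nat) : {poly rat} :=
  \sum_(0 <= k < r) ('C(r.-1, k) * 'C(r, k))%:R *: 'X^k.

Lemma coef_narayana_power_sum r k :
  (narayana_power_sum r.+1)`_k = 'C(r, k)%:R * 'C(r.+1, k)%:R.
Proof.
rewrite /narayana_power_sum big_mkord.
rewrite -(poly_def r.+1 (fun k => ('C(r, k) * 'C(r.+1, k))%:R)) coef_poly /=.
by rewrite natrM; case: ltnP => // lt_rk; rewrite bin_small ?mul0r.
Qed.

(** The factor [n%:R] absorbs the exceptional value of [narayana] at n = 0, where both sides
    vanish. *)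
Lemma coef_narayana n k :
  n%:R * (narayana n)`_k = 'C(n, k)%:R * 'C(n, k.+1)%:R.
Proof.
case: n => [|n]; first by rewrite mul0r bin0n mulr0.
rewrite /narayana big_add1 /= big_mkord.
rewrite -(poly_def n.+1
  (fun k => n.+1%:R^-1 * 'C(n.+1, k)%:R * 'C(n.+1, k.+1)%:R)).
rewrite coef_poly; case: ltnP => [_|lt_nk].
  by rewrite -mulrA mulVKf // pnatr_eq0.
by rewrite [X in _ * X%:R]bin_small ?mulr0.
Qed.

Lemma coef_narayanaS n k :
  (narayana n.+1)`_k = 'C(n.+1, k)%:R * 'C(n.+1, k.+1)%:R / n.+1%:R.
Proof. by rewrite -coef_narayana mulrC mulKf // pnatr_eq0. Qed.

Lemma natr_binS (F : numFieldType) n k :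
  'C(n, k.+1)%:R = (n%:R - k%:R) * 'C(n, k)%:R / k.+1%:R :> F.
Proof.
apply: (mulIf (x := k.+1%:R)); first by rewrite pnatr_eq0.
rewrite mulfVK ?pnatr_eq0 //.
have [le_kn|lt_nk] := leqP k n; last first.
  by rewrite !bin_small ?mulr0 ?mul0r // ltnW.
by rewrite -natrB // -!natrM mulnC mul_bin_left.
Qed.

Lemma natr_bin_pred (F : numFieldType) n k :
  'C(n, k)%:R = (n.+1%:R - k%:R) * 'C(n.+1, k)%:R / n.+1%:R :> F.
Proof.
apply: (mulIf (x := n.+1%:R)); first by rewrite pnatr_eq0.
rewrite mulfVK ?pnatr_eq0 //.
have [le_kn|lt_nk] := leqP k n.+1; last first.
  by rewrite !bin_small ?mulr0 ?mul0r // ltnW.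
by rewrite -natrB // -!natrM mulnC mul_bin_down.
Qed.

Lemma narayana0 : narayana 0 = 1.
Proof. by []. Qed.

Lemma narayana1 : narayana 1 = 1.
Proof. by rewrite /narayana big_nat1 /= invr1 !mul1r scale1r. Qed.

(** This is the coefficient of u^(n+2) in the differential equation for C. *)
Lemma narayana_rec n :
  n.+3%:R *: narayana n.+2
  = (n * 2).+3%:R *: (narayana n.+1 + 'X * narayana n.+1)
    - ('X * ('X * (n%:R *: narayana n)) - 2 *: ('X * (n%:R *: narayana n))
       + n%:R *: narayana n).
Proof.
apply/polyP => k; rewrite !(coefD, coefN, coefZ, coefXM, coef_narayana).
rewrite !coef_narayanaS.
(* From X^2 on, the binomials reduce to 'C(n, k) without null denominators. *)
case: k => [|[|k]] /=; rewrite !(binS, bin0, natrD, natr_binS).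
all: by field; rewrite !nat1r -!natrD !pnatr_eq0.
Qed.

Lemma narayana_power_sum_rec n :
  narayana_power_sum n.+3
  = 2 *: (narayana_power_sum n.+2 + 'X * narayana_power_sum n.+2)
    - ('X * ('X * narayana_power_sum n.+1) - 2 *: ('X * narayana_power_sum n.+1)
       + narayana_power_sum n.+1)
    - 'X * narayana n.+2 + 'X * ('X * narayana n.+1) - 'X * narayana n.+1.
Proof.
apply/polyP => k.
rewrite !(coefD, coefN, coefZ, coefXM, coef_narayana_power_sum).
rewrite !coef_narayanaS.
case: k => [|[|k]] /=; rewrite !(binS, bin0, natrD, natr_binS).
- by field; rewrite ?nat1r -?natrD ?pnatr_eq0.
- by field; rewrite ?nat1r -?natrD ?pnatr_eq0.
(* Both ['C(n, k)] and ['C(n.+1, k)] remain. Passing to the latter divides by n+1, whereas the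
   converse would divide by n+1-k, which may be zero. *)
rewrite natr_bin_pred.
by field; rewrite ?nat1r -?natrD ?pnatr_eq0.
Qed.

Lemma narayana_power_sum0 : narayana_power_sum 0 = 0.
Proof. by rewrite /narayana_power_sum big_geq. Qed.

Lemma narayana_power_sum1 : narayana_power_sum 1 = 1.
Proof. by rewrite /narayana_power_sum big_nat1 mul1n scale1r. Qed.

Lemma narayana_power_sum2 : narayana_power_sum 2 = 1 + 'X *+ 2.
Proof.
rewrite /narayana_power_sum big_nat_recr //= big_nat1.
by rewrite scale1r scaler_nat.
Qed.

(** * Generating series modulo u^N *)

Arguments narayana : simpl never.

(** Congruences modulo u^N between truncated series survive multiplication. *)
Lemma low_coefMl (R : nzRingType) (N : nat) (p r : {poly R}) :
  (forall i, (i < N)%N -> p`_i = 0) -> forall i, (i < N)%N -> (r * p)`_i = 0.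
Proof.
move=> p0 i lt_iN; rewrite coefM big1 // => j _.
by rewrite p0 ?mulr0 // (leq_ltn_trans (leq_subr _ _)).
Qed.

Lemma low_coefXM (R : nzRingType) (N : nat) (p : {poly R}) :
  (forall i, (i < N)%N -> p`_i = 0) ->
  forall i, (i < N.+1)%N -> ('X * p)`_i = 0.
Proof. by move=> p0 [|i] lt_iN; rewrite coefXM //= p0. Qed.

Lemma coefX_deriv (R : nzRingType) (p : {poly R}) i :
  ('X * p^`())`_i = p`_i *+ i.
Proof. by case: i => [|i]; rewrite coefXM // coef_deriv. Qed.

Section GeneratingFunctions.
Context (N : nat).

Let u : {poly {poly rat}} := 'X.
Let q : {poly {poly rat}} := 'X%:P.
(* Truncations in degree N of the two series, in Q[q][u]. *)
Let C : {poly {poly rat}} := \poly_(n < N) narayana n.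
Let P : {poly {poly rat}} := \poly_(n < N) narayana_power_sum n.
Let a : {poly {poly rat}} := (1 + q) * u - 1.
Let b : {poly {poly rat}} := 1 + (1 - q) * u.
Let s : {poly {poly rat}} := 1 + (q - 1) * u.
Let D : {poly {poly rat}} := 1 - 2 * (1 + q) * u + (q - 1) ^+ 2 * u ^+ 2.
Let E : {poly {poly rat}} := q * u * C ^+ 2 - s * C + 1.

Lemma narayana_ode i : (i < N)%N -> (u * D * C^`() - a * C - b)`_i = 0.
Proof.
move=> lt_iN.
have -> : u * D * C^`() - a * C - b
  = (u * C^`() + C) - 1 - u
    - (u * (u * C^`() *+ 2 + C) + q * (u * (u * C^`() *+ 2 + C)) - q * u)
   + (q * (q * (u * (u * (u * C^`())))) - (q * (u * (u * (u * C^`())))) *+ 2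
      + u * (u * (u * C^`()))).
  by rewrite /D /a /b; ring.
have coefuC' j : (u * C^`())`_j = C`_j *+ j by apply: coefX_deriv.
move: (u * C^`()) coefuC' => M coefuC'.
rewrite /u /q !(coefD, coefN, coefCM, coefXM, coefMn, coef1, coefX).
rewrite !coefuC' !coef_poly.
case: i lt_iN => [|[|n]] lt_iN; rewrite //=.
- by rewrite lt_iN /= narayana0; ring.
- by rewrite lt_iN (ltn_trans _ lt_iN) //= narayana0 narayana1; ring.
rewrite lt_iN !(ltn_trans _ lt_iN) //=.
have /eqP := narayana_rec n; rewrite -subr_eq0 !scaler_nat => /eqP rec.
rewrite -[RHS]rec; ring.
Qed.

Lemma narayana_power_sum_gf i : (i < N)%N ->
  (D * P - (a + b * (s - q * u * C)))`_i = 0.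
Proof.
have -> : D * P - (a + b * (s - q * u * C))
  = P - (u * P + q * (u * P)) *+ 2
    + (q * (q * (u * (u * P))) - q * (u * (u * P)) *+ 2 + u * (u * P))
    - u - q * u + (u * (q * (q * u)) - u * (q * u) *+ 2 + u * u)
    + q * (u * C) + q * (u * (u * C)) - q * (q * (u * (u * C))).
  by rewrite /D /a /b /s; ring.
move=> lt_iN.
rewrite /u /q /C /P !(coefD, coefN, coefCM, coefXM, coefMn, coef1, coefX).
rewrite !coef_poly.
case: i lt_iN => [|[|[|n]]] lt_iN; rewrite /=.
- by rewrite lt_iN /= narayana_power_sum0; ring.
- rewrite lt_iN !(ltn_trans _ lt_iN) //= narayana_power_sum0.
  by rewrite narayana_power_sum1 narayana0; ring.
- rewrite lt_iN !(ltn_trans _ lt_iN) //= narayana_power_sum0.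
  by rewrite narayana_power_sum1 narayana_power_sum2 narayana0 narayana1; ring.
rewrite lt_iN !(ltn_trans _ lt_iN) //= narayana_power_sum_rec !scaler_nat; ring.
Qed.

Lemma derivE_quadratic :
  E^`() = q * C ^+ 2 + 2 * q * u * C * C^`() - (q - 1) * C - s * C^`().
Proof. by rewrite /E /s /u /q !derivE; ring. Qed.

Lemma narayana_quadratic i : (i < N)%N -> E`_i = 0.
Proof.
have ode j : (j < N)%N -> (u * D * E^`() - (D + 2 * a) * E)`_j = 0.
  (* The factor [2 * q * u * C - s] is the derivative of [E] with respect to [C]. *)
  have -> : u * D * E^`() - (D + 2 * a) * E
            = (2 * q * u * C - s) * (u * D * C^`() - a * C - b).
    by rewrite derivE_quadratic /E /D /a /b /s; ring.
  by apply: low_coefMl; apply: narayana_ode.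
elim/ltn_ind: i => i IH lt_iN.
have E0 j : (j < i)%N -> E`_j = 0.
  by move=> lt_ji; apply: IH => //; apply: ltn_trans lt_iN.
have uE'0 j : (j < i)%N -> (u * E^`())`_j = 0.
  by move=> lt_ji; rewrite coefX_deriv E0 ?mul0rn.
have := ode i lt_iN.
have -> : u * D * E^`() - (D + 2 * a) * E
  = u * E^`() + E + u * (((q - 1) ^+ 2 * u - 2 * (1 + q)) * (u * E^`()))
    - u * (((q - 1) ^+ 2 * u) * E).
  by rewrite /D /a; ring.
rewrite coefB 2!coefD coefX_deriv.
rewrite [X in _ + X - _](low_coefXM _ i) ?[X in _ - X](low_coefXM _ i) //;
  try exact: low_coefMl.
rewrite subr0 addr0 -mulrSr -scaler_nat => /eqP.
by rewrite scaler_eq0 pnatr_eq0 => /eqP.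
Qed.

Lemma narayana_newton_gf i : (i < N)%N -> (C * P - u * C^`())`_i = 0.
Proof.
pose Z := C * P - u * C^`(); rewrite -/Z.
have DZ0 j : (j < N)%N -> (D * Z)`_j = 0.
  move=> lt_jN.
  have -> : D * Z = C * (D * P - (a + b * (s - q * u * C)))
                    - (u * D * C^`() - a * C - b) - b * E.
    by rewrite /Z /E; ring.
  rewrite 2!coefB narayana_ode //.
  rewrite (low_coefMl _ N) ?(low_coefMl _ N) ?subrr ?subr0 //.
    exact: narayana_quadratic.
  exact: narayana_power_sum_gf.
(* As [D] has constant term 1, the vanishing of [D * Z] passes to [Z] one coefficient at a time. *)
elim/ltn_ind: i => i IH lt_iN.
have Z0 j : (j < i)%N -> Z`_j = 0.
  by move=> lt_ji; apply: IH => //; apply: ltn_trans lt_iN.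
have := DZ0 i lt_iN.
have -> : D * Z = Z + u * (((q - 1) ^+ 2 * u - 2 * (1 + q)) * Z).
  by rewrite /D; ring.
rewrite coefD (low_coefXM _ i) ?addr0 //.
exact: low_coefMl.
Qed.

End GeneratingFunctions.

(** * Newton's identities under the specialization *)

Lemma narayana_newton n :
  n.+1%:R * narayana n.+1
  = \sum_(i < n.+1) narayana i * narayana_power_sum (n - i).+1.
Proof.
(* Degree n+1 must lie below the truncation, hence n+2. The last term of the convolution vanishes
   since [narayana_power_sum 0] is 0. *)
have /eqP := narayana_newton_gf n.+2 n.+1 (ltnSn _).
rewrite coefB coefX_deriv subr_eq0 coefM big_ord_recr /= subnn.
rewrite !coef_poly ltnSn narayana_power_sum0 mulr0 addr0 mulr_natl => /eqP <-.
apply: eq_bigr => i _; rewrite !coef_poly.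
by rewrite ltnS ltnW // ltnS leq_subr subSn // -ltnS.
Qed.

Theorem theorem8 (A : {lrmorphism symfun rat -> {poly rat}})
    (A_narayana : is_narayana_alphabet A) (r : nat) (r_gt0 : (0 < r)%N) :
  A (sf_power_sum rat r_gt0)
  = \sum_(0 <= k < r) ('C(r.-1, k) * 'C(r, k))%:R *: 'X^k.
Proof.
case: r r_gt0 => // r r_gt0; rewrite (bool_irrelevance r_gt0 (ltn0Sn r)).
rewrite -/(narayana_power_sum r.+1).
elim/ltn_ind: r {r_gt0} => r IH.
have : r.+1%:R * A (sf_complete rat r.+1)
       = \sum_(i < r.+1)
           A (sf_complete rat i) * A (sf_power_sum rat (ltn0Sn (r - i))).
  rewrite -(rmorph_nat A) -rmorphM newton_complete rmorph_sum.
  by apply: eq_bigr => i _; apply: rmorphM.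
rewrite A_narayana narayana_newton.
(* The term i = 0 holds the unknown power sum with coefficient 1; the others agree by induction and
   cancel. *)
rewrite [X in X = _]big_ord_recl [X in _ = X]big_ord_recl.
rewrite A_narayana /= subn0 narayana0 !mul1r.
rewrite [X in _ + X](eq_bigr (fun i : 'I_r => A (sf_complete rat (lift ord0 i))
    * A (sf_power_sum rat (ltn0Sn (r - lift ord0 i))))) => [/addIr //|i _].
rewrite A_narayana; congr (_ * _); symmetry; apply: IH.
by rewrite ltn_subrL (leq_trans _ (ltn_ord i)).
Qed.
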